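(* Assume that there is some prior information about the channel at time $i$ collected in $\boldsymbol{\zeta}(i)$, and that the receiver employs the MMSE combiner $$\mathbf{g}^\star(\mathbf{q},i)=\alpha_1\sqrt{P_{{\rm d},1}}\;\mathbf{z}_1^{H}\mathbf{F}(i)^{-1}$$ to estimate the data symbols of the tagged user (user 1) at time slot $i$. Then the instantaneous signal-to-interference-plus-noise ratio (SINR) of the data symbol of the tagged user at time slot $i$ is $$\gamma(\mathbf{q},i,\boldsymbol{\zeta}(i))=\alpha_1^2P_{{\rm d},1}\,\mathbf{z}_1^{H}\left(\mathbf{F}(i)-\alpha_1^2P_{{\rm d},1}\mathbf{z}_1\mathbf{z}_1^{H}\right)^{-1}\mathbf{z}_1=\alpha_1^2P_{{\rm d},1}\,\mathbf{z}_1^{H}\mathbf{F}_1^{-1}(i)\,\mathbf{z}_1,$$ where $\mathbf{F}_1(i)=\mathbf{F}(i)-\alpha_1^2P_{{\rm d},1}\mathbf{z}_1\mathbf{z}_1^{H}$.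
   Context: There are $K$ single-antenna users and a base station with $N_r$ antennas. At data slot $i$ the received signal is $\mathbf{y}(i)=\sum_{k=1}^K\alpha_k\mathbf{h}_k(i)\sqrt{P_{{\rm d},k}}\,x_k(i)+\mathbf{n}_{\rm d}(i)\in\mathbb{C}^{N_r\times1}$, where $\alpha_k$ is the large-scale fading, $P_{{\rm d},k}$ the data power, $\mathbf{h}_k(i)$ the random channel of user $k$ with mean $\overline{\mathbf{h}}_k(i)$ and covariance $\mathbf{C}_{\mathbf{h}_k(i)}$, $x_k(i)$ the data symbol (zero mean and unit variance), and $\mathbf{n}_{\rm d}(i)\sim\mathcal{CN}(\mathbf{0},\sigma_{\rm d}^2\mathbf{I}_{N_r})$ the noise. Transmission is organized in frames of sizes $\mathbf{q}=(q_1,\dots,q_M)$, the first slot of each frame being a pilot slot. $\widehat{\mathbf{h}}_k(\mathbf{q},i)$ is the linear MMSE estimate of $\mathbf{h}_k(i)$ computed from the received pilot signals of the previous, current and next frames, and $\mathbf{C}_{\widehat{\mathbf{h}}_k(\mathbf{q},i)}$ is its covariance matrix. Let $i_{\rm p}<i$ be an arbitrary earlier slot. The centered channel of user $k$, $\widetilde{\mathbf{h}}_k(t)=\mathbf{h}_k(t)-\overline{\mathbf{h}}_k(t)$, follows a first-order autoregressive model with state transition matrix $\mathbf{A}_k(t)=\mathbb{E}[\widetilde{\mathbf{h}}_k(t+1)\widetilde{\mathbf{h}}_k(t)^{H}]\,\mathbb{E}[\widetilde{\mathbf{h}}_k(t)\widetilde{\mathbf{h}}_k(t)^{H}]^{-1}$.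 Define, for $k=1,\dots,K$, $$\boldsymbol{\zeta}_k(i)=\begin{bmatrix}\widehat{\mathbf{h}}_k(\mathbf{q},i)\\ \widehat{\mathbf{h}}_k(\mathbf{q},i_{\rm p})\end{bmatrix}\in\mathbb{C}^{2N_r\times1},\qquad \widetilde{\boldsymbol{\zeta}}_k(i)=\boldsymbol{\zeta}_k(i)-\begin{bmatrix}\overline{\mathbf{h}}_k(i)\\ \overline{\mathbf{h}}_k(i)\end{bmatrix},\qquad \boldsymbol{\zeta}(i)=\boldsymbol{\zeta}_1(i),$$ $$\boldsymbol{\Psi}_k=\begin{bmatrix}\mathbf{C}_{\widehat{\mathbf{h}}_k(\mathbf{q},i)} & \mathbf{A}_k(i_{\rm p})\mathbf{C}_{\widehat{\mathbf{h}}_k(\mathbf{q},i_{\rm p})}\end{bmatrix}\begin{bmatrix}\mathbf{C}_{\widehat{\mathbf{h}}_k(\mathbf{q},i)} & \mathbf{A}_k(i_{\rm p})\mathbf{C}_{\widehat{\mathbf{h}}_k(\mathbf{q},i_{\rm p})}\\ \mathbf{C}_{\widehat{\mathbf{h}}_k(\mathbf{q},i_{\rm p})}\mathbf{A}_k(i_{\rm p})^{H} & \mathbf{C}_{\widehat{\mathbf{h}}_k(\mathbf{q},i_{\rm p})}\end{bmatrix}^{-1},$$ $$\mathbf{z}_k=\overline{\mathbf{h}}_k(i)+\boldsymbol{\Psi}_k\widetilde{\boldsymbol{\zeta}}_k(i),\qquad \mathbf{Q}_k=\mathbf{C}_{\mathbf{h}_k(i)}-\boldsymbol{\Psi}_k\begin{bmatrix}\mathbf{C}_{\widehat{\mathbf{h}}_k(\mathbf{q},i)}\\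 \mathbf{C}_{\widehat{\mathbf{h}}_k(\mathbf{q},i_{\rm p})}\mathbf{A}_k(i_{\rm p})^{H}\end{bmatrix},$$ $$\mathbf{D}_k=\mathbf{Q}_k+\mathbf{z}_k\mathbf{z}_k^{H},\qquad \mathbf{F}(i)=\sum_{k=1}^K\alpha_k^2P_{{\rm d},k}\mathbf{D}_k+\sigma_{\rm d}^2\mathbf{I}_{N_r}.$$ Here $\mathbf{z}_k$ and $\mathbf{Q}_k$ play the role of the mean and covariance of $\mathbf{h}_k(i)$ given $\boldsymbol{\zeta}_k(i)$, i.e. $\mathbf{D}_k=\mathbb{E}[\mathbf{h}_k(i)\mathbf{h}_k(i)^{H}\mid\boldsymbol{\zeta}_k(i)]$. The data estimate with combiner $\mathbf{g}\in\mathbb{C}^{1\times N_r}$ is $\widehat{x}=\mathbf{g}\mathbf{y}$, and the instantaneous SINR of user 1 is the ratio $$\gamma=\frac{\alpha_1^2P_{{\rm d},1}\,\langle\mathbf{z}_1\mathbf{z}_1^{H},\mathbf{g}^{H}\mathbf{g}\rangle}{\sum_{k=2}^K\alpha_k^2P_{{\rm d},k}\langle\mathbf{z}_k\mathbf{z}_k^{H},\mathbf{g}^{H}\mathbf{g}\rangle+\sum_{k=1}^K\alpha_k^2P_{{\rm d},k}\langle\mathbf{Q}_k,\mathbf{g}^{H}\mathbf{g}\rangle+\sigma_{\rm d}^2\|\mathbf{g}\|_2^2},$$ evaluated at $\mathbf{g}=\mathbf{g}^\star(\mathbf{q},i)$, where $\langle\mathbf{A},\mathbf{B}\rangle=\mathrm{trace}(\mathbf{A}^{H}\mathbf{B})$.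 *)

(* Defs.v *)
From HB Require Import structures.
From mathcomp Require Import all_boot all_order all_algebra.
From mathcomp Require Export sesquilinear spectral.
From mathcomp Require Import all_classical all_reals all_analysis.
From mathcomp Require Export complex.

Set Implicit Arguments.
Unset Strict Implicit.
Unset Printing Implicit Defensive.

Import Order.TTheory GRing.Theory Num.Theory.
Local Open Scope classical_set_scope.
Local Open Scope ring_scope.
Local Open Scope complex_scope.
Local Open Scope sesquilinear_scope.

Definition cexp {R : realType} {d : measure_display} {T : measurableType d}
    (Pr : probability T R) (X : T -> R[i]) : R[i] :=
  fine ('E_Pr[fun w => complex.Re (X w)])%E +i*
  fine ('E_Pr[fun w => complex.Im (X w)])%E.

Definition mexp {R : realType} {d : measure_display} {T : measurableType d}
    (Pr : probability T R) {m n : nat} (X : T -> 'M[R[i]]_(m, n)) :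
    'M[R[i]]_(m, n) :=
  \matrix_(a, b) cexp Pr (fun w => X w a b).

Definition centered {R : realType} {d : measure_display} {T : measurableType d}
    (Pr : probability T R) {n : nat} (X : T -> 'cV[R[i]]_n) (w : T) :
    'cV[R[i]]_n :=
  X w - mexp Pr X.

Definition crosscov {R : realType} {d : measure_display} {T : measurableType d}
    (Pr : probability T R) {m n : nat}
    (X : T -> 'cV[R[i]]_m) (Y : T -> 'cV[R[i]]_n) : 'M[R[i]]_(m, n) :=
  mexp Pr (fun w => centered Pr X w *m (centered Pr Y w)^t*).

Definition cov {R : realType} {d : measure_display} {T : measurableType d}
    (Pr : probability T R) {n : nat} (X : T -> 'cV[R[i]]_n) : 'M[R[i]]_n :=
  crosscov Pr X X.

Definition square_integrable {R : realType} {d : measure_display}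
    {T : measurableType d} (Pr : probability T R) (X : T -> R[i]) : Prop :=
  (fun w => complex.Re (X w)) \in Lfun Pr 2%:E /\
  (fun w => complex.Im (X w)) \in Lfun Pr 2%:E.

Definition second_order {R : realType} {d : measure_display}
    {T : measurableType d} (Pr : probability T R) {n : nat}
    (X : T -> 'cV[R[i]]_n) : Prop :=
  forall a, square_integrable Pr (fun w => X w a 0).

Definition sqnorm {R : realType} {m n : nat} (A : 'M[R[i]]_(m, n)) : R :=
  \sum_a \sum_b (complex.Re (A a b) ^+ 2 + complex.Im (A a b) ^+ 2).

(* X ~ CN(0, sigma^2 I): the real and imaginary parts of all the entries are
   independent, each of them normal with mean 0 and variance sigma^2 / 2. *)
Definition complex_gaussian {R : realType} {d : measure_display}
    {T : measurableType d} (Pr : probability T R) {n : nat} (sigma : R)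
    (X : T -> 'cV[R[i]]_n) : Prop :=
  (forall a, measurable_fun setT (fun w => complex.Re (X w a 0)) /\
             measurable_fun setT (fun w => complex.Im (X w a 0))) /\
  forall A B : 'I_n -> set R,
    (forall a, measurable (A a)) -> (forall a, measurable (B a)) ->
    Pr [set w | forall a, A a (complex.Re (X w a 0)) /\
                          B a (complex.Im (X w a 0))] =
    (\prod_(a < n) (normal_prob 0 (sigma / Num.sqrt 2) (A a) *
                    normal_prob 0 (sigma / Num.sqrt 2) (B a)))%E.

(* Slots and frames are numbered from 0: frame m occupies the q m slots
   frame_start q m, frame_start q m + 1, ... and its first slot is its pilot
   slot. *)
Definition frame_start {M : nat} (q : 'I_M -> nat) (m : 'I_M) : nat :=
  (\sum_(j < M | (j < m)%N) q j)%N.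

Definition in_frame {M : nat} (q : 'I_M -> nat) (m : 'I_M) (t : nat) : bool :=
  (frame_start q m <= t < frame_start q m + q m)%N.

Definition data_slot {M : nat} (q : 'I_M -> nat) (t : nat) : bool :=
  [exists m, in_frame q m t && (t != frame_start q m)].

(* m is the frame of slot t, the one before it or the one after it (the first
   frame has no previous frame, the last one has no next frame). *)
Definition neighbour_frame {M : nat} (q : 'I_M -> nat) (t : nat) (m : 'I_M) :
    bool :=
  [exists m0 : 'I_M,
     [&& in_frame q m0 t, (m0 <= m.+1)%N & (m <= m0.+1)%N]].

(* The value at w of the affine estimator with coefficients W, b applied to the
   pilot signals of the previous, current and next frames of slot t. *)
Definition pilot_affine {R : realType} {T : Type} {M Np Nr : nat}
    (q : 'I_M -> nat) (yp : nat -> T -> 'cV[R[i]]_Np) (t : nat)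
    (W : 'I_M -> 'M[R[i]]_(Nr, Np)) (b : 'cV[R[i]]_Nr) (w : T) :
    'cV[R[i]]_Nr :=
  b + \sum_(m | neighbour_frame q t m) W m *m yp (frame_start q m) w.

(* The channel means are known, so "linear" MMSE estimates are affine. *)
Definition is_lmmse {R : realType} {d : measure_display} {T : measurableType d}
    (Pr : probability T R) {M Np Nr : nat} (q : 'I_M -> nat)
    (yp : nat -> T -> 'cV[R[i]]_Np) (t : nat)
    (h hhat : T -> 'cV[R[i]]_Nr) : Prop :=
  (exists W b, hhat = pilot_affine q yp t W b) /\
  forall W b,
    ('E_Pr[fun w => sqnorm (h w - hhat w)] <=
     'E_Pr[fun w => sqnorm (h w - pilot_affine q yp t W b w)])%E.

Definition state_transition {R : realType} {d : measure_display}
    {T : measurableType d} (Pr : probability T R) {n : nat}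
    (h : nat -> T -> 'cV[R[i]]_n) (t : nat) : 'M[R[i]]_n :=
  crosscov Pr (h t.+1) (h t) *m invmx (cov Pr (h t)).

(* First-order autoregression in the wide sense: the innovation at t + 1 is
   uncorrelated with the present and the past. *)
Definition is_AR1 {R : realType} {d : measure_display} {T : measurableType d}
    (Pr : probability T R) {n : nat} (h : nat -> T -> 'cV[R[i]]_n) : Prop :=
  (forall t, cov Pr (h t) \in unitmx) /\
  forall s t, (s <= t)%N ->
    mexp Pr (fun w =>
      (centered Pr (h t.+1) w -
       state_transition Pr h t *m centered Pr (h t) w) *m
      (centered Pr (h s) w)^t*) = 0.

(* K.+1 users, the tagged user 1 being ord0; no pilot transmission scheme is
   imposed on the received pilot signals. *)
Record uplink {R : realType} {d : measure_display} {T : measurableType d}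
    (Pr : probability T R) (K Nr Np M : nat) : Type := Uplink {
  alpha : 'I_K.+1 -> R;
  Pd : 'I_K.+1 -> R;
  sigmad : R;
  frame_size : 'I_M -> nat;
  channel : 'I_K.+1 -> nat -> T -> 'cV[R[i]]_Nr;
  symbol : 'I_K.+1 -> nat -> T -> R[i];
  noise : nat -> T -> 'cV[R[i]]_Nr;
  received : nat -> T -> 'cV[R[i]]_Nr;
  pilot : nat -> T -> 'cV[R[i]]_Np;
  estimate : 'I_K.+1 -> nat -> T -> 'cV[R[i]]_Nr;
  Pd_ge0 : forall k, 0 <= Pd k;
  sigmad_gt0 : 0 < sigmad;
  frame_size_gt0 : forall m, (0 < frame_size m)%N;
  channel_second_order : forall k t, second_order Pr (channel k t);
  channel_AR1 : forall k, is_AR1 Pr (channel k);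
  symbol_second_order : forall k t, square_integrable Pr (symbol k t);
  symbol_mean : forall k t, cexp Pr (symbol k t) = 0;
  symbol_variance : forall k t,
    cexp Pr (fun w => symbol k t w * (symbol k t w)^*) = 1;
  noise_gaussian : forall t, complex_gaussian Pr sigmad (noise t);
  receivedE : forall t w, data_slot frame_size t ->
    received t w =
    \sum_k ((alpha k * Num.sqrt (Pd k))%:C * symbol k t w) *: channel k t w
    + noise t w;
  pilot_second_order : forall t, second_order Pr (pilot t);
  estimate_lmmse : forall k t, (t < \sum_m frame_size m)%N ->
    is_lmmse Pr frame_size pilot t (channel k t) (estimate k t)
}.

Definition zeta {R : realType} {d : measure_display} {T : measurableType d}
    {Pr : probability T R} {K Nr Np M : nat} (U : uplink Pr K Nr Np M)
    (i ip : nat) (k : 'I_K.+1) (w : T) : 'cV[R[i]]_(Nr + Nr) :=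
  col_mx (estimate U k i w) (estimate U k ip w).

(* Both blocks are centered at the mean of the channel at slot i. *)
Definition zeta_tilde {R : realType} {d : measure_display}
    {T : measurableType d} {Pr : probability T R} {K Nr Np M : nat}
    (U : uplink Pr K Nr Np M) (i ip : nat) (k : 'I_K.+1) (w : T) :
    'cV[R[i]]_(Nr + Nr) :=
  zeta U i ip k w - col_mx (mexp Pr (channel U k i)) (mexp Pr (channel U k i)).

Definition Psi_left {R : realType} {d : measure_display} {T : measurableType d}
    {Pr : probability T R} {K Nr Np M : nat} (U : uplink Pr K Nr Np M)
    (i ip : nat) (k : 'I_K.+1) : 'M[R[i]]_(Nr, Nr + Nr) :=
  row_mx (cov Pr (estimate U k i))
         (state_transition Pr (channel U k) ip *m cov Pr (estimate U k ip)).

Definition Psi_block {R : realType} {d : measure_display} {T : measurableType d}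
    {Pr : probability T R} {K Nr Np M : nat} (U : uplink Pr K Nr Np M)
    (i ip : nat) (k : 'I_K.+1) : 'M[R[i]]_(Nr + Nr) :=
  let A := state_transition Pr (channel U k) ip in
  block_mx (cov Pr (estimate U k i)) (A *m cov Pr (estimate U k ip))
           (cov Pr (estimate U k ip) *m A^t*) (cov Pr (estimate U k ip)).

Definition Psi {R : realType} {d : measure_display} {T : measurableType d}
    {Pr : probability T R} {K Nr Np M : nat} (U : uplink Pr K Nr Np M)
    (i ip : nat) (k : 'I_K.+1) : 'M[R[i]]_(Nr, Nr + Nr) :=
  Psi_left U i ip k *m invmx (Psi_block U i ip k).

(* z and Q play the role of the mean and of the covariance of the channel at
   slot i given zeta. *)
Definition z {R : realType} {d : measure_display} {T : measurableType d}
    {Pr : probability T R} {K Nr Np M : nat} (U : uplink Pr K Nr Np M)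
    (i ip : nat) (k : 'I_K.+1) (w : T) : 'cV[R[i]]_Nr :=
  mexp Pr (channel U k i) + Psi U i ip k *m zeta_tilde U i ip k w.

Definition Q {R : realType} {d : measure_display} {T : measurableType d}
    {Pr : probability T R} {K Nr Np M : nat} (U : uplink Pr K Nr Np M)
    (i ip : nat) (k : 'I_K.+1) : 'M[R[i]]_Nr :=
  cov Pr (channel U k i) -
  Psi U i ip k *m
    col_mx (cov Pr (estimate U k i))
           (cov Pr (estimate U k ip) *m
            (state_transition Pr (channel U k) ip)^t*).

Definition D {R : realType} {d : measure_display} {T : measurableType d}
    {Pr : probability T R} {K Nr Np M : nat} (U : uplink Pr K Nr Np M)
    (i ip : nat) (k : 'I_K.+1) (w : T) : 'M[R[i]]_Nr :=
  Q U i ip k + z U i ip k w *m (z U i ip k w)^t*.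

Definition gain {R : realType} {d : measure_display} {T : measurableType d}
    {Pr : probability T R} {K Nr Np M : nat} (U : uplink Pr K Nr Np M)
    (k : 'I_K.+1) : R[i] :=
  (alpha U k ^+ 2 * Pd U k)%:C.

Definition F {R : realType} {d : measure_display} {T : measurableType d}
    {Pr : probability T R} {K Nr Np M : nat} (U : uplink Pr K Nr Np M)
    (i ip : nat) (w : T) : 'M[R[i]]_Nr :=
  \sum_k gain U k *: D U i ip k w + ((sigmad U ^+ 2)%:C)%:M.

Definition F1 {R : realType} {d : measure_display} {T : measurableType d}
    {Pr : probability T R} {K Nr Np M : nat} (U : uplink Pr K Nr Np M)
    (i ip : nat) (w : T) : 'M[R[i]]_Nr :=
  F U i ip w - gain U ord0 *: (z U i ip ord0 w *m (z U i ip ord0 w)^t*).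

Definition mmse_combiner {R : realType} {d : measure_display}
    {T : measurableType d} {Pr : probability T R} {K Nr Np M : nat}
    (U : uplink Pr K Nr Np M) (i ip : nat) (w : T) : 'rV[R[i]]_Nr :=
  (alpha U ord0 * Num.sqrt (Pd U ord0))%:C *:
    ((z U i ip ord0 w)^t* *m invmx (F U i ip w)).

Definition mxinner {R : realType} {m n : nat} (A B : 'M[R[i]]_(m, n)) : R[i] :=
  \tr (A^t* *m B).

(* The ratio is computed in R[i], although its value is real. *)
Definition sinr {R : realType} {d : measure_display} {T : measurableType d}
    {Pr : probability T R} {K Nr Np M : nat} (U : uplink Pr K Nr Np M)
    (i ip : nat) (g : 'rV[R[i]]_Nr) (w : T) : R[i] :=
  let zz k := z U i ip k w *m (z U i ip k w)^t* in
  let gg := g^t* *m g in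
  gain U ord0 * mxinner (zz ord0) gg /
  (\sum_(k | k != ord0) gain U k * mxinner (zz k) gg
   + \sum_k gain U k * mxinner (Q U i ip k) gg
   + (sigmad U ^+ 2 * sqnorm g)%:C).

(* Main.v *)
(* Each Psi_k is the first block row of a matrix times the inverse of that
   matrix, so Psi_k = [I 0] and Q_k is the covariance of the channel minus that
   of its LMMSE estimate.  By minimality of the mean square error the estimation
   error is uncorrelated with the centered estimate, so Q_k is hermitian positive
   semidefinite.  Hence F_1 = sum_{k > 1} c_k z_k z_k^H + sum_k c_k Q_k +
   sigma^2 I is hermitian positive definite.  The SINR denominator is g F_1 g^H,
   and F = F_1 + c_1 z_1 z_1^H, so Sherman-Morrison gives the formula. *)
Require Import Defs.
From mathcomp Require Import all_boot all_order all_algebra.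
From mathcomp Require Import all_classical all_reals all_analysis.
From mathcomp Require Import ring lra.

Set Implicit Arguments.
Unset Strict Implicit.
Unset Printing Implicit Defensive.

Import Order.TTheory GRing.Theory Num.Theory.
Local Open Scope ring_scope.
Local Open Scope complex_scope.
Local Open Scope sesquilinear_scope.

(** * Hermitian forms and the rank-one update *)

Section PositiveDefinite.
Variable C : numClosedFieldType.
Implicit Types m n p : nat.

Lemma conjtrM m n p (A : 'M[C]_(m, n)) (B : 'M[C]_(n, p)) :
  (A *m B)^t* = B^t* *m A^t*.
Proof. by rewrite trmx_mul map_mxM. Qed.

Lemma conjtrK m n (A : 'M[C]_(m, n)) : (A^t*)^t* = A.
Proof. by apply/matrixP => a b; rewrite !mxE conjCK. Qed.

Lemma conjtrZ m n (a : C) (A : 'M[C]_(m, n)) : (a *: A)^t* = Num.conj a *: A^t*.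
Proof. by apply/matrixP => i j; rewrite !mxE rmorphM. Qed.

Lemma conjtrE m n (A : 'M[C]_(m, n)) i j : (A^t*) i j = Num.conj (A j i).
Proof. by rewrite !mxE. Qed.

Lemma mx11_conjtr (A : 'M[C]_1) : (A^t*) 0 0 = Num.conj (A 0 0).
Proof. by rewrite !mxE. Qed.

Lemma mx11M (A B : 'M[C]_1) : (A *m B) 0 0 = A 0 0 * B 0 0.
Proof. by rewrite mxE big_ord1. Qed.

(** The argument is a row because combiners are rows. *)
Definition qform n (A : 'M[C]_n) (v : 'rV[C]_n) : C := (v *m A *m v^t*) 0 0.

Lemma qformD n (A B : 'M[C]_n) v : qform (A + B) v = qform A v + qform B v.
Proof. by rewrite /qform mulmxDr mulmxDl mxE. Qed.

Lemma qformB n (A B : 'M[C]_n) v : qform (A - B) v = qform A v - qform B v.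
Proof. by rewrite /qform mulmxBr mulmxBl !mxE. Qed.

Lemma qformZ n a (A : 'M[C]_n) v : qform (a *: A) v = a * qform A v.
Proof. by rewrite /qform -scalemxAr -scalemxAl mxE. Qed.

Lemma qform_sum n I (r : seq I) (P : pred I) (A : I -> 'M[C]_n) v :
  qform (\sum_(k <- r | P k) A k) v = \sum_(k <- r | P k) qform (A k) v.
Proof.
apply: (big_morph (fun A => qform A v)); first by move=> *; exact: qformD.
by rewrite /qform mulmx0 mul0mx mxE.
Qed.

Lemma qform_dyad n (u : 'cV[C]_n) v :
  qform (u *m u^t*) v = `|(v *m u) 0 0| ^+ 2.
Proof.
rewrite /qform mulmxA -mulmxA -conjtrM mx11M mx11_conjtr.
by rewrite normCK.
Qed.

Lemma mul_rV_conjtr n (v : 'rV[C]_n) :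
  (v *m v^t*) 0 0 = \sum_a `|v 0 a| ^+ 2.
Proof. by rewrite mxE; apply: eq_bigr => a _; rewrite !mxE normCK. Qed.

Lemma qform_scalar n a (v : 'rV[C]_n) :
  qform a%:M v = a * \sum_j `|v 0 j| ^+ 2.
Proof. by rewrite /qform mul_mx_scalar -scalemxAl mxE mul_rV_conjtr. Qed.

(** A nonzero row [v] of the left kernel would satisfy [v *m A = 0], so the form would vanish at
    it. *)
Lemma posdef_unitmx n (A : 'M[C]_n) :
  (forall v, v != 0 -> 0 < qform A v) -> A \in unitmx.
Proof.
move=> A_gt0; rewrite -row_free_unit -kermx_eq0; apply/eqP/row_matrixP => j.
rewrite row0; apply/eqP/negPn/negP => /A_gt0.
by rewrite /qform -row_mul mulmx_ker row0 mul0mx mxE ltxx.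
Qed.

(* With r = z^H B^-1 and t = r z >= 0, Sherman-Morrison gives
   z^H (B + c z z^H)^-1 = r / (1 + c t), so the numerator is
   c^2 t^2 / (1 + c t)^2 and the denominator c t / (1 + c t)^2. *)
Lemma rank_one_ratio n (B : 'M[C]_n) (z : 'cV[C]_n) (a c : C) :
  `|a| ^+ 2 = c -> B^t* = B -> (forall v, v != 0 -> 0 < qform B v) ->
  let g := a *: (z^t* *m invmx (B + c *: (z *m z^t*))) in
  c * `|(g *m z) 0 0| ^+ 2 / qform B g = c * (z^t* *m invmx B *m z) 0 0.
Proof.
move=> ac Bh B_gt0.
have c0 : 0 <= c by rewrite -ac exprn_ge0.
have Bu := posdef_unitmx B_gt0.
have B_ge0 v : 0 <= qform B v.
  have [->|/B_gt0/ltW //] := eqVneq v 0.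
  by rewrite /qform mul0mx mul0mx mxE.
have Fu : B + c *: (z *m z^t*) \in unitmx.
  apply: posdef_unitmx => v /B_gt0 v0.
  by rewrite qformD qformZ qform_dyad ltr_wpDr // mulr_ge0 // exprn_ge0.
set r := z^t* *m invmx B; set t := (r *m z) 0 0 => g.
(* As [B] is hermitian, so is its inverse, and the form at z^H B^-1 collapses to z^H B^-1 z. Hence
   [t] is a value of a positive form, and 1 + c t cannot vanish. *)
have qr : qform B r = t.
  rewrite /qform /r mulmxKV // conjtrM conjtrK -map_trmx trmx_inv
    map_invmx map_trmx.
  by rewrite Bh mulmxA.
have t0 : 0 <= t by rewrite -qr.
have d0 : 0 < 1 + c * t by rewrite ltr_pwDl // mulr_ge0.
(* Sherman-Morrison is checked by multiplying back: r B = z^H and r z = t. *)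
have rF : r *m (B + c *: (z *m z^t*)) = (1 + c * t) *: z^t*.
  rewrite mulmxDr /r mulmxKV // -/r -scalemxAr mulmxA [r *m z]mx11_scalar -/t.
  by rewrite mul_scalar_mx scalerA scalerDl scale1r.
have gE : g = (a / (1 + c * t)) *: r.
  rewrite /g -scalerA; congr (_ *: _).
  apply: (can_inj (mulmxK Fu)); rewrite mulmxKV // -scalemxAl rF scalerA.
  by rewrite mulVf ?scale1r // gt_eqF.
have qg : qform B g = `|a / (1 + c * t)| ^+ 2 * t.
  rewrite gE /qform conjtrZ -!scalemxAl -scalemxAr scalerA mxE -/(qform B r).
  by rewrite qr normCK.
rewrite qg gE -scalemxAl mxE -/t !normrM normfV (ger0_norm t0)
  (gtr0_norm d0) !exprMn ac.
(* The form at [g] vanishes when [t] or [c] does. In these cases the numerator is 0 as well and both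
   sides are 0; otherwise c t can be cancelled. *)
have [->|t_neq0] := eqVneq t 0; first by rewrite !(mulr0, expr0n, mul0r).
have [->|c_neq0] := eqVneq c 0; first by rewrite !mul0r.
by field; rewrite t_neq0 c_neq0 gt_eqF.
Qed.

End PositiveDefinite.

(** * Real and imaginary parts *)

Section ReIm.
Variable R : realType.
Implicit Types x y : R[i].

Lemma ReD x y : complex.Re (x + y) = complex.Re x + complex.Re y.
Proof. by case: x y => ? ? []. Qed.

Lemma ImD x y : complex.Im (x + y) = complex.Im x + complex.Im y.
Proof. by case: x y => ? ? []. Qed.

Lemma ReM x y : complex.Re (x * y) =
  complex.Re x * complex.Re y - complex.Im x * complex.Im y.
Proof. by case: x y => ? ? []. Qed.

Lemma ImM x y : complex.Im (x * y) =
  complex.Re x * complex.Im y + complex.Im x * complex.Re y.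
Proof. by case: x y => ? ? []. Qed.

Lemma ReJ x : complex.Re (Num.conj x) = complex.Re x.
Proof. by case: x. Qed.

Lemma ImJ x : complex.Im (Num.conj x) = - complex.Im x.
Proof. by case: x. Qed.
End ReIm.

(** * Integrability and linearity of the complex expectation *)

Section Expectation.
Context {R : realType} {d : measure_display} {T : measurableType d}.
Variable Pr : probability T R.
Implicit Types X Y : T -> R[i].

(** [cexp] passes through [fine], so its algebraic rules are stated under a condition that makes
    both expectations finite. *)
Definition integrableC X : Prop :=
  (fun w => complex.Re (X w)) \in Lfun Pr 1 /\
  (fun w => complex.Im (X w)) \in Lfun Pr 1.

Lemma LfunD (p : \bar R) (f g : T -> R) : (1 <= p)%E ->
  f \in Lfun Pr p -> g \in Lfun Pr p -> (fun w => f w + g w) \in Lfun Pr p.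
Proof. by move=> p1 f1 g1; have [_ +] := Lfun_addr_closed Pr p1; exact. Qed.

Lemma LfunN (p : \bar R) (f : T -> R) :
  f \in Lfun Pr p -> (fun w => - f w) \in Lfun Pr p.
Proof. by move=> f1; rewrite -[X in X \in _]/(- f) rpredN. Qed.

Lemma LfunZ (p : \bar R) (a : R) (f : T -> R) : (1 <= p)%E ->
  f \in Lfun Pr p -> (fun w => a * f w) \in Lfun Pr p.
Proof. move=> p1 f1.
have [L0 LZ] := Lfun_submod_closed Pr p1.
by have := LZ a f 0 f1 L0; rewrite addr0. Qed.

Lemma LfunM (f g : T -> R) : f \in Lfun Pr 2%:E -> g \in Lfun Pr 2%:E ->
  (fun w => f w * g w) \in Lfun Pr 1.
Proof. exact: Lfun2_mul_Lfun1. Qed.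

Lemma square_integrableD X Y : square_integrable Pr X ->
  square_integrable Pr Y -> square_integrable Pr (fun w => X w + Y w).
Proof.
move=> [X1 X2] [Y1 Y2]; split; under eq_fun do rewrite ?ReD ?ImD;
  by apply: LfunD; rewrite ?lee1n.
Qed.

Lemma square_integrableZ a X : square_integrable Pr X ->
  square_integrable Pr (fun w => a * X w).
Proof.
move=> [X1 X2]; split; under eq_fun do rewrite ?ReM ?ImM -?mulNr;
  by apply: LfunD; rewrite ?lee1n//; apply: LfunZ; rewrite ?lee1n.
Qed.

Lemma square_integrable_cst a : square_integrable Pr (fun=> a).
Proof. by split; apply: Lfun_cst. Qed.

Lemma square_integrableJ X : square_integrable Pr X ->
  square_integrable Pr (fun w => Num.conj (X w)).
Proof.
move=> [X1 X2]; split; under eq_fun do rewrite ?ReJ ?ImJ; first by [].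
exact: LfunN.
Qed.

Lemma square_integrableM X Y : square_integrable Pr X ->
  square_integrable Pr Y -> integrableC (fun w => X w * Y w).
Proof.
move=> [X1 X2] [Y1 Y2]; split; under eq_fun do rewrite ?ReM ?ImM -?mulNr;
  by apply: LfunD => //; apply: LfunM => //; apply: LfunN.
Qed.

Lemma square_integrable_sum I (r : seq I) (P : pred I) (X : I -> T -> R[i]) :
  (forall k, square_integrable Pr (X k)) ->
  square_integrable Pr (fun w => \sum_(k <- r | P k) X k w).
Proof.
move=> XL; elim: r => [|k r IH].
  under eq_fun do rewrite big_nil.
  exact: square_integrable_cst.
under eq_fun do rewrite big_cons.
by case: (P k) => //; apply: square_integrableD.
Qed.

(** On a probability space the constant 1 is square integrable, so X = 1 * X is a product of two
    square integrable variables. *)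
Lemma square_integrable_integrableC X :
  square_integrable Pr X -> integrableC X.
Proof.
move=> XL; have := square_integrableM (square_integrable_cst 1) XL.
by under eq_fun do rewrite mul1r.
Qed.

Lemma integrableCD X Y : integrableC X -> integrableC Y ->
  integrableC (fun w => X w + Y w).
Proof.
by move=> [X1 X2] [Y1 Y2]; split; under eq_fun do rewrite ?ReD ?ImD;
  apply: LfunD.
Qed.

Lemma integrableCZ a X : integrableC X -> integrableC (fun w => a * X w).
Proof.
by move=> [X1 X2]; split; under eq_fun do rewrite ?ReM ?ImM -?mulNr;
  apply: LfunD => //; apply: LfunZ.
Qed.

Lemma integrableC_cst a : integrableC (fun=> a).
Proof. exact/square_integrable_integrableC/square_integrable_cst. Qed.

Lemma integrableC_sum I (r : seq I) (P : pred I) (X : I -> T -> R[i]) :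
  (forall k, integrableC (X k)) ->
  integrableC (fun w => \sum_(k <- r | P k) X k w).
Proof.
move=> XL; elim: r => [|k r IH].
  under eq_fun do rewrite big_nil.
  exact: integrableC_cst.
under eq_fun do rewrite big_cons.
by case: (P k) => //; apply: integrableCD.
Qed.

Definition rexp (f : T -> R) : R := fine ('E_Pr[f])%E.

Lemma rexpD (f g : T -> R) : f \in Lfun Pr 1 -> g \in Lfun Pr 1 ->
  rexp (fun w => f w + g w) = rexp f + rexp g.
Proof.
move=> f1 g1; rewrite /rexp -fineD ?expectation_fin_num//.
by rewrite -expectationD.
Qed.

Lemma rexpZ a (f : T -> R) : f \in Lfun Pr 1 ->
  rexp (fun w => a * f w) = a * rexp f.
Proof.
move=> f1; rewrite /rexp -[a in RHS]/(fine a%:E) -fineM ?expectation_fin_num//.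
rewrite -expectationZl//; congr (fine ('E_Pr[_]))%E.
by apply/funext => w /=; rewrite mulrC.
Qed.

Lemma cexpE X : cexp Pr X =
  rexp (fun w => complex.Re (X w)) +i* rexp (fun w => complex.Im (X w)).
Proof. by []. Qed.

Lemma cexpD X Y : integrableC X -> integrableC Y ->
  cexp Pr (fun w => X w + Y w) = cexp Pr X + cexp Pr Y.
Proof.
move=> [X1 X2] [Y1 Y2]; rewrite !cexpE.
under [X in rexp X +i* _]eq_fun do rewrite ReD.
under [X in _ +i* rexp X]eq_fun do rewrite ImD.
by rewrite !rexpD.
Qed.

Lemma cexpZ a X : integrableC X ->
  cexp Pr (fun w => a * X w) = a * cexp Pr X.
Proof.
move=> [X1 X2]; rewrite !cexpE.
under [X in rexp X +i* _]eq_fun do rewrite ReM -mulNr.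
under [X in _ +i* rexp X]eq_fun do rewrite ImM.
rewrite !rexpD ?rexpZ ?LfunZ//; case: a => a b /=.
by rewrite mulNr.
Qed.

Lemma cexp_cst a : cexp Pr (fun=> a) = a.
Proof. by rewrite /cexp !expectation_cst; case: a. Qed.

Lemma cexp_conj X : integrableC X ->
  cexp Pr (fun w => Num.conj (X w)) = Num.conj (cexp Pr X).
Proof.
move=> [X1 X2]; rewrite !cexpE.
under [X in rexp X +i* _]eq_fun do rewrite ReJ.
under [X in _ +i* rexp X]eq_fun do rewrite ImJ -mulN1r.
by rewrite rexpZ// mulN1r.
Qed.

Lemma cexp_sum I (r : seq I) (P : pred I) (X : I -> T -> R[i]) :
  (forall k, integrableC (X k)) ->
  cexp Pr (fun w => \sum_(k <- r | P k) X k w) =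
  \sum_(k <- r | P k) cexp Pr (X k).
Proof.
move=> XL; elim: r => [|k r IH].
  under eq_fun do rewrite big_nil.
  by rewrite cexp_cst big_nil.
under eq_fun do rewrite big_cons.
rewrite big_cons.
case: (P k) => //; rewrite cexpD ?IH//; exact: integrableC_sum.
Qed.

Lemma cexp_real (f : T -> R) : cexp Pr (fun w => (f w)%:C) = (rexp f)%:C.
Proof. by rewrite cexpE /= /rexp expectation_cst. Qed.

(** Nonnegativity in [R[i]] includes being real. An infinite expectation is harmless, since [fine]
    sends it to 0. *)
Lemma cexp_normsq_ge0 X : 0 <= cexp Pr (fun w => `|X w| ^+ 2).
Proof.
under eq_fun do rewrite -add_Re2_Im2.
rewrite cexp_real lecR fine_ge0// expectation_ge0// => w.
by rewrite addr_ge0// sqr_ge0.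
Qed.

End Expectation.

(** * Squared norms and the variational inequality *)

Lemma sqnormE {R : realType} {n : nat} (u : 'cV[R[i]]_n) :
  (sqnorm u)%:C = \sum_a `|u a 0| ^+ 2.
Proof.
rewrite /sqnorm rmorph_sum; apply: eq_bigr => a _.
by rewrite big_ord1 -add_Re2_Im2.
Qed.

Lemma sqnorm_rowE {R : realType} {n : nat} (g : 'rV[R[i]]_n) :
  (sqnorm g)%:C = \sum_a `|g 0 a| ^+ 2.
Proof.
rewrite /sqnorm big_ord1 rmorph_sum; apply: eq_bigr => a _.
by rewrite -add_Re2_Im2.
Qed.

Lemma conj_realC {R : realType} (s : R) : Num.conj s%:C = s%:C.
Proof. by rewrite /Num.conj /= oppr0. Qed.

(** Pointwise error of a perturbed estimator as a polynomial in the real parameter [s]. Its linear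
    coefficient is, up to sign, twice the real part of y times the conjugate of v e. *)
Lemma sqnorm_subZ {R : realType} {n : nat} (e : 'cV[R[i]]_n) (v : 'rV[R[i]]_n)
    (y : R[i]) (s : R) :
  (sqnorm (e - (s%:C * y) *: v^t*))%:C =
  (sqnorm e)%:C
  + - s%:C * (y * Num.conj ((v *m e) 0 0) + Num.conj y * (v *m e) 0 0)
  + s%:C ^+ 2 * (sqnorm v)%:C * `|y| ^+ 2.
Proof.
rewrite !sqnormE sqnorm_rowE mxE rmorph_sum !mulr_sumr -big_split /=.
rewrite mulr_sumr mulr_suml -!big_split /=; apply: eq_bigr => a _.
rewrite !mxE !normCK rmorphB !rmorphM /= conjCK conj_realC; ring.
Qed.

Lemma quadratic_ge0_lin_eq0 {R : realFieldType} (a b : R) : 0 <= b ->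
  (forall s, 0 <= - s * a + s ^+ 2 * b) -> a = 0.
Proof.
(* Dividing by [b + 1] instead of [b] covers the case b = 0; the quadratic is still negative at this
   point unless a = 0. *)
move=> b0 /(_ (a / (b + 1))); have b1 : 0 < b + 1 by lra.
have -> : - (a / (b + 1)) * a + (a / (b + 1)) ^+ 2 * b =
    - (a ^+ 2 / (b + 1) ^+ 2) by field; rewrite gt_eqF.
rewrite oppr_ge0 pmulr_lle0 ?invr_gt0 ?exprn_gt0// => a2.
by apply/eqP; rewrite -sqrf_eq0 eq_le a2 sqr_ge0.
Qed.

(** * Covariances of second-order random vectors *)

Section SecondOrder.
Context {R : realType} {d : measure_display} {T : measurableType d}.
Variable Pr : probability T R.

Lemma rexp_le (f g : T -> R) : f \in Lfun Pr 1 -> g \in Lfun Pr 1 ->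
  ('E_Pr[f] <= 'E_Pr[g])%E -> rexp Pr f <= rexp Pr g.
Proof. by move=> f1 g1; apply: fine_le; exact: expectation_fin_num. Qed.

Lemma square_integrable_lin n (v : 'rV[R[i]]_n) (X : T -> 'cV[R[i]]_n) :
  second_order Pr X -> square_integrable Pr (fun w => (v *m X w) 0 0).
Proof.
move=> XL; under eq_fun do rewrite mxE.
by apply: square_integrable_sum => k; apply: square_integrableZ.
Qed.

Lemma second_order_cst n (b : 'cV[R[i]]_n) : second_order Pr (fun=> b).
Proof. by move=> a; apply: square_integrable_cst. Qed.

Lemma second_orderD n (X Y : T -> 'cV[R[i]]_n) :
  second_order Pr X -> second_order Pr Y ->
  second_order Pr (fun w => X w + Y w).
Proof.
move=> XL YL a; under eq_fun do rewrite mxE; exact: square_integrableD.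
Qed.

Lemma second_orderB n (X Y : T -> 'cV[R[i]]_n) :
  second_order Pr X -> second_order Pr Y ->
  second_order Pr (fun w => X w - Y w).
Proof.
move=> XL YL; apply: second_orderD => // a.
under eq_fun do rewrite mxE -mulN1r; exact: square_integrableZ.
Qed.

Lemma second_order_centered n (X : T -> 'cV[R[i]]_n) :
  second_order Pr X -> second_order Pr (centered Pr X).
Proof. by move=> XL; apply: second_orderB => //; apply: second_order_cst. Qed.

Lemma cexp_centered n (v : 'rV[R[i]]_n) (X : T -> 'cV[R[i]]_n) :
  second_order Pr X -> cexp Pr (fun w => (v *m centered Pr X w) 0 0) = 0.
Proof.
move=> XL; under eq_fun do rewrite mxE.
rewrite cexp_sum; last first.
  move=> k; apply/integrableCZ/square_integrable_integrableC.
  exact: second_order_centered.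
rewrite big1// => k _; rewrite cexpZ; last first.
  by apply/square_integrable_integrableC; exact: second_order_centered.
under eq_fun do rewrite !mxE.
rewrite cexpD ?cexp_cst ?subrr ?mulr0//; last exact: integrableC_cst.
exact: square_integrable_integrableC.
Qed.

Lemma cexp_qform n (v : 'rV[R[i]]_n) (X : T -> 'M[R[i]]_n) :
  (forall a b, integrableC Pr (fun w => X w a b)) ->
  cexp Pr (fun w => qform (X w) v) = qform (mexp Pr X) v.
Proof.
move=> XL; rewrite /qform mxE.
under eq_fun do rewrite mxE.
have L b : integrableC Pr (fun w => (v *m X w) 0 b).
  under eq_fun do rewrite mxE.
  by apply: integrableC_sum => k; apply: integrableCZ.
under eq_fun do under eq_bigr do rewrite mulrC.
rewrite cexp_sum => [|b]; last exact: integrableCZ.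
apply: eq_bigr => b _; rewrite cexpZ// mulrC; congr (_ * _).
rewrite mxE; under eq_fun do rewrite mxE.
rewrite cexp_sum => [|a]; last exact: integrableCZ.
by apply: eq_bigr => a _; rewrite cexpZ// !mxE.
Qed.

Lemma integrableC_cov n (X : T -> 'cV[R[i]]_n) a b : second_order Pr X ->
  integrableC Pr (fun w => (centered Pr X w *m (centered Pr X w)^t*) a b).
Proof.
move=> /second_order_centered XL; under eq_fun do rewrite mxE big_ord1 conjtrE.
by apply: square_integrableM => //; apply: square_integrableJ.
Qed.

(** Reduces matrix inequalities between covariances to variances of the scalars v X. *)
Lemma qform_cov n (v : 'rV[R[i]]_n) (X : T -> 'cV[R[i]]_n) : second_order Pr X ->
  qform (cov Pr X) v = cexp Pr (fun w => `|(v *m centered Pr X w) 0 0| ^+ 2).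
Proof.
move=> XL; rewrite -cexp_qform => [|a b]; last exact: integrableC_cov.
by under eq_fun do rewrite qform_dyad.
Qed.

Lemma cov_conjtr n (X : T -> 'cV[R[i]]_n) : second_order Pr X ->
  (cov Pr X)^t* = cov Pr X.
Proof.
move=> XL; apply/matrixP => a b.
rewrite conjtrE [mexp _ _ _ _]mxE [mexp _ _ _ _]mxE -cexp_conj; last first.
  exact: integrableC_cov.
congr (cexp Pr _); apply/funext => w.
by rewrite ![(_ *m _) _ _]mxE !big_ord1 !conjtrE rmorphM /= conjCK mulrC.
Qed.

(** * Optimality of the linear MMSE estimate *)

Lemma second_order_pilot_affine M Np Nr (q : 'I_M -> nat)
    (yp : nat -> T -> 'cV[R[i]]_Np) t (W : 'I_M -> 'M[R[i]]_(Nr, Np)) b :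
  (forall s, second_order Pr (yp s)) ->
  second_order Pr (pilot_affine q yp t W b).
Proof.
move=> ypL; apply: second_orderD; first exact: second_order_cst.
move=> a; under eq_fun do rewrite summxE.
apply: square_integrable_sum => m; under eq_fun do rewrite mxE.
by apply: square_integrable_sum => j; apply: square_integrableZ; apply: ypL.
Qed.

(** Affine estimators are stable under hhat -> hhat + S (hhat - m), which supplies the competitors
    for the minimality argument. *)
Lemma pilot_affine_perturb M Np Nr (q : 'I_M -> nat)
    (yp : nat -> T -> 'cV[R[i]]_Np) t (W : 'I_M -> 'M[R[i]]_(Nr, Np)) b
    (S : 'M[R[i]]_Nr) (m : 'cV_Nr) w :
  pilot_affine q yp t (fun k => (1%:M + S) *m W k) ((1%:M + S) *m b - S *m m) w
  = pilot_affine q yp t W b w + S *m (pilot_affine q yp t W b w - m).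
Proof.
rewrite /pilot_affine; under eq_bigr do rewrite -mulmxA.
rewrite -mulmx_sumr mulmxBr [in RHS]mulmxDr !mulmxDl !mul1mx.
rewrite -[_ + S *m b - _]addrA addrACA.
by rewrite [_ - _ + S *m _]addrAC.
Qed.

(* Perturbing the estimate by the affine term s v^H y, y = v (hhat - E hhat),
   minimality for all real s makes the error of v h uncorrelated (in real part)
   with y, so that Var (v h) = Var (v hhat) + Var (v h - v hhat). *)
Lemma lmmse_cov_le M Np Nr (q : 'I_M -> nat) (yp : nat -> T -> 'cV[R[i]]_Np) t
    (h hhat : T -> 'cV[R[i]]_Nr) (v : 'rV[R[i]]_Nr) :
  (forall s, second_order Pr (yp s)) -> second_order Pr h ->
  is_lmmse Pr q yp t h hhat -> 0 <= qform (cov Pr h - cov Pr hhat) v.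
Proof.
move=> ypL hL [[W [b hhatE]] hmin].
have kL : second_order Pr hhat by rewrite hhatE; exact: second_order_pilot_affine.
pose y w : R[i] := (v *m centered Pr hhat w) 0 0.
pose x w : R[i] := (v *m centered Pr h w) 0 0.
pose e w : 'cV[R[i]]_Nr := h w - hhat w.
pose ve w : R[i] := (v *m e w) 0 0.
have yL : square_integrable Pr y.
  exact/square_integrable_lin/second_order_centered.
have xL : square_integrable Pr x.
  exact/square_integrable_lin/second_order_centered.
have eL : second_order Pr e by exact: second_orderB.
have veL : square_integrable Pr ve by exact: square_integrable_lin.
have prodL X Y : square_integrable Pr X -> square_integrable Pr Y ->
    integrableC Pr (fun w => X w * Num.conj (Y w)).
  by move=> XL YL; apply: square_integrableM => //; apply: square_integrableJ.
have normL X : square_integrable Pr X -> integrableC Pr (fun w => `|X w| ^+ 2).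
  by move=> XL; under eq_fun do rewrite normCK; exact: prodL.
have sqL (u : T -> 'cV[R[i]]_Nr) : second_order Pr u ->
    integrableC Pr (fun w => (sqnorm (u w))%:C).
  move=> uL; under eq_fun do rewrite sqnormE.
  by apply: integrableC_sum => a; apply: normL.
pose p := cexp Pr (fun w => y w * Num.conj (ve w)).
have prod2L X : square_integrable Pr X ->
    integrableC Pr (fun w => Num.conj (y w) * X w).
  by move=> XL; under eq_fun do rewrite mulrC; exact: prodL.
have crossL X : square_integrable Pr X ->
    integrableC Pr (fun w => y w * Num.conj (X w) + Num.conj (y w) * X w).
  by move=> XL; apply: integrableCD; [exact: prodL|exact: prod2L].
have crossE X : square_integrable Pr X ->
    cexp Pr (fun w => y w * Num.conj (X w) + Num.conj (y w) * X w) =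
    cexp Pr (fun w => y w * Num.conj (X w)) +
    Num.conj (cexp Pr (fun w => y w * Num.conj (X w))).
  move=> XL; rewrite cexpD; [|exact: prodL|exact: prod2L].
  congr (_ + _); rewrite -cexp_conj; last exact: prodL.
  by congr (cexp Pr _); apply/funext => w; rewrite rmorphM /= conjCK.
have pJ : p + Num.conj p = (complex.Re p *+ 2)%:C.
  by rewrite addcJ mulr_natl rmorphMn.
(* Coefficient of s^2 in the mean square error of the perturbed estimate. *)
pose B := sqnorm v * rexp Pr (fun w => complex.Re (`|y w| ^+ 2)).
have normE (X : T -> R[i]) : cexp Pr (fun w => `|X w| ^+ 2) =
    (rexp Pr (fun w => complex.Re (`|X w| ^+ 2)))%:C.
  rewrite -cexp_real; congr (cexp Pr _); apply/funext => w.
 by rewrite -add_Re2_Im2.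
have min s : 0 <= - s * (complex.Re p *+ 2) + s ^+ 2 * B.
  (* With this rank-one [S], the term S (hhat - E hhat) equals s y v^H. *)
  pose S := s%:C *: (v^t* *m v).
  have := hmin (fun k => (1%:M + S) *m W k)
    ((1%:M + S) *m b - S *m mexp Pr hhat).
  have pertE w : h w - pilot_affine q yp t (fun k => (1%:M + S) *m W k)
      ((1%:M + S) *m b - S *m mexp Pr hhat) w =
      e w - (s%:C * y w) *: v^t*.
    rewrite pilot_affine_perturb -hhatE opprD addrA; congr (_ - _).
    rewrite /S -scalemxAl -mulmxA [v *m _]mx11_scalar -/(y w).
    by rewrite mul_mx_scalar scalerA.
  under [in X in (_ <= X)%E -> _]eq_fun do rewrite pertE.
  have reL (u : T -> 'cV[R[i]]_Nr) : second_order Pr u ->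
      (fun w => sqnorm (u w)) \in Lfun Pr 1 by move=> /sqL [].
  have uL : second_order Pr (fun w => e w - (s%:C * y w) *: v^t*).
    apply: second_orderB => // a; under eq_fun do rewrite mxE mulrAC.
    exact: square_integrableZ.
  move=> /(rexp_le (reL _ eL) (reL _ uL)).
  rewrite -lecR -!cexp_real.
  under [X in _ <= cexp _ X]eq_fun do rewrite sqnorm_subZ.
  rewrite cexpD; [|by apply: integrableCD; [exact: sqL|exact/integrableCZ/crossL]
                  |exact/integrableCZ/normL].
  rewrite cexpD; [|exact: sqL|exact/integrableCZ/crossL].
  rewrite (cexpZ _ (crossL _ veL)) (cexpZ _ (normL _ yL)) crossE// -/p normE pJ.
  by rewrite -addrA lerDl -!rmorphN -!rmorphXn -!rmorphM -rmorphD lecR /B mulrA.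
have p0 : p + Num.conj p = 0.
  rewrite pJ (quadratic_ge0_lin_eq0 _ min)//.
  apply: mulr_ge0; first by apply: sumr_ge0 => a _; apply: sumr_ge0 => c _;
    rewrite addr_ge0// sqr_ge0.
  by rewrite -lecR -normE cexp_normsq_ge0.
rewrite qformB !qform_cov// -/x -/y.
pose r := cexp Pr (fun w => y w * Num.conj (x w)).
pose Ny := cexp Pr (fun w => `|y w| ^+ 2).
(* The error need not have mean zero: v e = x - y + k with [k] the difference of the projected
   means. The constant [k] multiplies the centered [y] and drops out of the expectation. *)
have pE : p = r - Ny.
  pose k := (v *m (mexp Pr h - mexp Pr hhat)) 0 0.
  have veE w : y w * Num.conj (ve w) =
      y w * Num.conj (x w) + (-1 * `|y w| ^+ 2 + Num.conj k * y w).
    have -> : ve w = x w - y w + k.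
      have eE : e w = centered Pr h w - centered Pr hhat w +
          (mexp Pr h - mexp Pr hhat).
        rewrite /e /centered opprD opprK addrACA -addrA.
        by rewrite addrK addrA subrK.
      rewrite /ve /x /y /k eE mulmxDr mulmxBr.
      move: (v *m centered _ h w) (v *m centered _ hhat w) (v *m _) => ? ? ?.
      by rewrite !mxE.
    by rewrite normCK rmorphD rmorphB /=; ring.
  rewrite /p; under eq_fun do rewrite veE.
  rewrite cexpD; [|exact: prodL|apply: integrableCD; apply: integrableCZ].
  - rewrite cexpD; [|exact/integrableCZ/normL
                    |exact/integrableCZ/square_integrable_integrableC].
    rewrite (cexpZ _ (normL _ yL)) cexpZ; last first.
      exact: square_integrable_integrableC.
    by rewrite cexp_centered// mulr0 addr0 mulN1r.
  - exact: normL.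
  - exact: square_integrable_integrableC.
have NyJ : Num.conj Ny = Ny by rewrite /Ny normE conj_realC.
have rJ : r + Num.conj r = Ny *+ 2.
  by move: p0; rewrite pE rmorphB /= NyJ addrACA -opprD => /subr0_eq.
(* By [rJ] the cross term is 2 [Ny], so E|x - y|^2 = E|x|^2 - E|y|^2, which is the quantity to be
   bounded below. *)
have := cexp_normsq_ge0 Pr (fun w => x w - y w).
have diffE w : `|x w - y w| ^+ 2 = `|x w| ^+ 2 + (`|y w| ^+ 2 +
    -1 * (y w * Num.conj (x w) + Num.conj (y w) * x w)).
  by rewrite !normCK rmorphB /=; ring.
under eq_fun do rewrite diffE.
rewrite cexpD; [|exact: normL
  |by apply: integrableCD; [exact: normL|exact/integrableCZ/crossL]].
rewrite cexpD; [|exact: normL|exact/integrableCZ/crossL].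
rewrite (cexpZ _ (crossL _ xL)) crossE// -/r rJ -/Ny.
by rewrite mulN1r mulr2n opprD addNKr.
Qed.

End SecondOrder.

(** Cyclicity of the trace; the adjoint comes from the first argument of the inner product. *)
Lemma mxinner_dyad {R : realType} {n : nat} (A : 'M[R[i]]_n) (g : 'rV[R[i]]_n) :
  mxinner A (g^t* *m g) = qform (A^t*) g.
Proof. by rewrite /mxinner mulmxA mxtrace_mulC trace_mx11 mulmxA. Qed.

Lemma dyad_conjtr {C : numClosedFieldType} {n : nat} (u : 'cV[C]_n) :
  (u *m u^t*)^t* = u *m u^t*.
Proof. by rewrite conjtrM conjtrK. Qed.

(** Brings data slots within the range of [estimate_lmmse]: the end of a frame is a partial sum of
    the frame sizes. *)
Lemma data_slot_lt {M : nat} (q : 'I_M -> nat) t :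
  data_slot q t -> (t < \sum_m q m)%N.
Proof.
move=> /existsP[m /andP[/andP[_ t_lt] _]]; apply: leq_trans t_lt _.
rewrite /frame_start [leqRHS](bigID (fun j : 'I_M => (j < m)%N)) leq_add2l.
by rewrite (bigD1 m) ?ltnn//= leq_addr.
Qed.

(** * The interference matrix and the SINR of the uplink *)

Section Uplink.
Context {R : realType} {d : measure_display} {T : measurableType d}.
Context {Pr : probability T R} {K Nr Np M : nat} (U : uplink Pr K Nr Np M).
Variables i ip : nat.

Lemma PsiE k : Psi_block U i ip k \in unitmx -> Psi U i ip k = row_mx 1%:M 0.
Proof.
move=> Pu; apply: (can_inj (mulmxK Pu)); rewrite mulmxKV//.
by rewrite mul_row_block !mul1mx !mul0mx !addr0.
Qed.

Lemma QE k : Psi_block U i ip k \in unitmx ->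
  Q U i ip k = cov Pr (channel U k i) - cov Pr (estimate U k i).
Proof. by move=> Pu; rewrite /Q PsiE// mul_row_col mul1mx mul0mx addr0. Qed.

Hypothesis it : (i < \sum_m frame_size U m)%N.

(** The estimate inherits its finite second moments from the pilot signals, being affine in them. *)
Lemma estimate_second_order k : second_order Pr (estimate U k i).
Proof.
have [[W [b ->]] _] := estimate_lmmse k it.
by apply: second_order_pilot_affine; exact: pilot_second_order.
Qed.

Lemma Q_conjtr k : Psi_block U i ip k \in unitmx ->
  (Q U i ip k)^t* = Q U i ip k.
Proof.
move=> Pu; rewrite QE// linearB map_mxB /= !cov_conjtr//.
  exact: estimate_second_order.
exact: channel_second_order.
Qed.

Lemma Q_ge0 k v : Psi_block U i ip k \in unitmx -> 0 <= qform (Q U i ip k) v.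
Proof.
move=> Pu; rewrite QE//; apply: lmmse_cov_le (estimate_lmmse k it).
  exact: pilot_second_order.
exact: channel_second_order.
Qed.

Lemma gain_ge0 k : 0 <= gain U k.
Proof. by rewrite /gain lecR mulr_ge0 ?sqr_ge0 ?Pd_ge0. Qed.

(** This is [F1] after the cancellation of the dyad of user 1; its three summands match those of the
    SINR denominator. *)
Definition interference w : 'M[R[i]]_Nr :=
  \sum_(k | k != ord0) gain U k *: (z U i ip k w *m (z U i ip k w)^t*) +
  \sum_k gain U k *: Q U i ip k + ((sigmad U ^+ 2)%:C)%:M.

Lemma F1E w : F1 U i ip w = interference w.
Proof.
rewrite /F1 /F /D /interference; under eq_bigr do rewrite scalerDr.
rewrite big_split /= [X in _ + X + _ - _](bigD1 ord0)//=.
by rewrite addrAC [gain U ord0 *: _ + _]addrC addrA addrK [X in X + _ = _]addrC.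
Qed.

Section Invertible.
Hypothesis hPsi : forall k, Psi_block U i ip k \in unitmx.

Lemma interference_conjtr w : (interference w)^t* = interference w.
Proof.
rewrite /interference !linearD /= !map_mxD !linear_sum /= !map_mx_sum.
congr (_ + _ + _).
- apply: eq_bigr => k _.
  by rewrite conjtrZ dyad_conjtr conj_realC.
- by apply: eq_bigr => k _; rewrite conjtrZ Q_conjtr// conj_realC.
- by rewrite tr_scalar_mx map_scalar_mx /= conj_realC.
Qed.

Lemma qform_interference w g : qform (interference w) g =
  \sum_(k | k != ord0) gain U k * mxinner (z U i ip k w *m (z U i ip k w)^t*)
                                         (g^t* *m g)
  + \sum_k gain U k * mxinner (Q U i ip k) (g^t* *m g)
  + (sigmad U ^+ 2 * sqnorm g)%:C.
Proof.
rewrite !qformD !qform_sum qform_scalar -sqnorm_rowE -rmorphM.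
congr (_ + _ + _); apply: eq_bigr => k _; rewrite qformZ mxinner_dyad.
  by rewrite dyad_conjtr.
by rewrite Q_conjtr.
Qed.

(** Dyads and [Q] contribute nonnegative terms; strictness comes from the noise term, as [sigmad] is
    positive. *)
Lemma interference_gt0 w v : v != 0 -> 0 < qform (interference w) v.
Proof.
move=> v0; rewrite !qformD !qform_sum qform_scalar ltr_wpDl//.
  apply: addr_ge0; apply: sumr_ge0 => k _; rewrite qformZ mulr_ge0 ?gain_ge0//.
    by rewrite qform_dyad exprn_ge0.
  exact: Q_ge0.
apply: mulr_gt0; first by rewrite ltcR exprn_gt0// sigmad_gt0.
rewrite lt_neqAle sumr_ge0 ?andbT => [|k _]; last exact: exprn_ge0.
apply: contraNneq v0 => /esym/eqP.
rewrite psumr_eq0 => [/allP v0|k _]; last exact: exprn_ge0.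
apply/eqP/rowP => k; have := v0 k (mem_index_enum k).
by rewrite sqrf_eq0 normr_eq0 mxE => /eqP.
Qed.

Lemma sinr_mmseE w : sinr U i ip (mmse_combiner U i ip w) w =
  gain U ord0 *
  ((z U i ip ord0 w)^t* *m invmx (F1 U i ip w) *m z U i ip ord0 w) 0 0.
Proof.
have FE : F U i ip w = interference w +
    gain U ord0 *: (z U i ip ord0 w *m (z U i ip ord0 w)^t*).
  by rewrite -F1E /F1 subrK.
(* Links the scale of the combiner to the weight of the rank-one term, as [rank_one_ratio] requires;
   [Pd_ge0] makes the square root genuine. *)
have aE : `|(alpha U ord0 * Num.sqrt (Pd U ord0))%:C| ^+ 2 = gain U ord0.
  by rewrite normCK conj_realC -rmorphM -expr2 exprMn sqr_sqrtr ?Pd_ge0.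
rewrite F1E -(rank_one_ratio _ aE (interference_conjtr w))//; last first.
  exact: interference_gt0.
by rewrite /sinr -qform_interference mxinner_dyad dyad_conjtr qform_dyad
  /mmse_combiner FE.
Qed.

End Invertible.

End Uplink.

Theorem theorem1 (R : realType) (d : measure_display) (T : measurableType d)
    (Pr : probability T R) (K Nr Np M : nat) (U : uplink Pr K Nr Np M)
    (i ip : nat)
    (hi : data_slot (frame_size U) i)
    (hip : (ip < i)%N)
    (hPsi : forall k, Psi_block U i ip k \in unitmx)
    (w : T) :
  sinr U i ip (mmse_combiner U i ip w) w =
    gain U ord0 *
    ((z U i ip ord0 w)^t* *m
     invmx (F U i ip w -
            gain U ord0 *: (z U i ip ord0 w *m (z U i ip ord0 w)^t*)) *m
     z U i ip ord0 w) 0 0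
  /\
  sinr U i ip (mmse_combiner U i ip w) w =
    gain U ord0 *
    ((z U i ip ord0 w)^t* *m invmx (F1 U i ip w) *m z U i ip ord0 w) 0 0.
Proof. by split; exact: (sinr_mmseE (data_slot_lt hi) hPsi w). Qed.
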